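(* Let $n\ge 3$. The relators $$a^2,\ b^2,\ c^2,\ d^2,\ bcd,\ u_0,\ldots,u_{n-3},\ v_0,\ldots,v_{n-4},\ w_n,\ t_n$$ of the presentation $$\mathcal{G}_n=\langle a,b,c,d \mid a^2,b^2,c^2,d^2,bcd,u_0,\ldots,u_{n-3},v_0,\ldots,v_{n-4},w_n,t_n\rangle$$ are independent; that is, in the free group on $\{a,b,c,d\}$, none of these relators lies in the normal closure of the others.
   Context: Let $F$ be the free group on $\{a,b,c,d\}$ and let $\sigma$ be the endomorphism of $F$ given by $a\mapsto aca$, $b\mapsto d$, $c\mapsto b$, $d\mapsto c$. Put $u_i=\sigma^i((ad)^4)$, $v_i=\sigma^i((adacac)^4)$ for $i\ge0$, and $w_n=\sigma^{n-3}((ac)^4)$, $t_n=\sigma^{n-3}((abac)^4)$ for $n\ge3$ (for $n=3$ the list $v_0,\dots,v_{n-4}$ is empty). Here $\mathcal{G}_n=\mathcal{G}/St_{\mathcal{G}}(n)$, where $\mathcal{G}$ is the Grigorchuk group: the group of automorphisms of the binary rooted tree $\{0,1\}^*$ generated by $a,b,c,d$ with $a(0w)=1w$, $a(1w)=0w$; $b(0w)=0\,a(w)$, $b(1w)=1\,c(w)$; $c(0w)=0\,a(w)$, $c(1w)=1\,d(w)$; $d(0w)=0w$, $d(1w)=1\,b(w)$, and $St_{\mathcal{G}}(n)$ is the subgroup fixing all words of length $n$. Relators of a presentation are called independent if none of them is a consequence of the others. *)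

(* Defs.v *)
From HB Require Import structures.
From mathcomp Require Import all_boot.

Set Implicit Arguments.
Unset Strict Implicit.
Unset Printing Implicit Defensive.

Local Open Scope group_scope.

(* The free group on T, as the set of reduced words over T * bool; the letter
   (x, false) stands for the generator x and (x, true) for its inverse. *)
Section FreeGroup.

Variable T : choiceType.

Notation letter := (T * bool)%type.

Definition linv (l : letter) : letter := (l.1, ~~ l.2).

Lemma linvK : involutive linv.
Proof. by case=> x e; rewrite /linv /= negbK. Qed.

Definition reduced (s : seq letter) : bool :=
  sorted (fun l m => m != linv l) s.

Record free_group : Type :=
  FreeGroup { fg_word :> seq letter; fg_wordP : reduced fg_word }.

HB.instance Definition _ := [isSub for fg_word].
HB.instance Definition _ := [Choice of free_group by <:].

Definition push (l : letter) (s : seq letter) : seq letter :=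
  if s is m :: s' then if m == linv l then s' else l :: s else [:: l].

Definition reduce (s : seq letter) : seq letter := foldr push [::] s.

Lemma push_reduced l s : reduced s -> reduced (push l s).
Proof.
case: s => [|m s] //= rs; case: ifP => [_|ml]; first exact: path_sorted rs.
by rewrite /reduced /= ml.
Qed.

Lemma foldr_push_reduced s t : reduced t -> reduced (foldr push t s).
Proof. by move=> rt; elim: s => //= l s; apply: push_reduced. Qed.

Lemma reduce_reduced s : reduced (reduce s).
Proof. exact: foldr_push_reduced. Qed.

Lemma reduce_id s : reduced s -> reduce s = s.
Proof.
elim: s => //= l s IHs rs; rewrite (IHs (path_sorted rs)) /push.
by case: s rs {IHs} => //= m s /andP[/negbTE-> _].
Qed.

Lemma pushK l s : reduced s -> push (linv l) (push l s) = s.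
Proof.
case: s => [|m s] /=; first by rewrite linvK eqxx.
case: eqP => [-> | _] rs; last by rewrite /= linvK eqxx.
by case: s rs => //= k s /andP[/negbTE-> _].
Qed.

Lemma foldr_push_push l s t :
  reduced t -> foldr push t (push l s) = push l (foldr push t s).
Proof.
move=> rt; case: s => //= m s; case: eqP => // ->.
by rewrite -{1}(linvK l) pushK // foldr_push_reduced.
Qed.

Lemma foldr_push_reduce s t :
  reduced t -> foldr push t (reduce s) = foldr push t s.
Proof. by move=> rt; elim: s => //= l s IHs; rewrite foldr_push_push ?IHs. Qed.

Lemma reduce_catl s t : reduce (reduce s ++ t) = reduce (s ++ t).
Proof.
by rewrite /reduce !foldr_cat foldr_push_reduce // reduce_reduced.
Qed.

Lemma reduce_catr s t : reduce (s ++ reduce t) = reduce (s ++ t).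
Proof.
by rewrite /reduce !foldr_cat -/(reduce _) -/(reduce t) reduce_id
  ?reduce_reduced.
Qed.

Definition word_inv (s : seq letter) : seq letter := rev (map linv s).

Lemma word_inv_reduced s : reduced s -> reduced (word_inv s).
Proof.
rewrite /reduced /word_inv rev_sorted sorted_map.
apply: sub_sorted => l m /=.
by rewrite linvK eq_sym => /eqP ml; apply/eqP => ml'; apply: ml.
Qed.

Lemma foldr_push_inv s t : reduced t -> foldr push t (word_inv s ++ s) = t.
Proof.
move=> rt; elim: s => //= l s IHs.
rewrite /word_inv /= rev_cons -cats1 -catA foldr_cat /=.
by rewrite pushK ?foldr_push_reduced // -foldr_cat.
Qed.

Definition fg_of_word (s : seq letter) : free_group :=
  FreeGroup (reduce_reduced s).
Definition fg_one : free_group := @FreeGroup [::] isT.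
Definition fg_mul (x y : free_group) : free_group := fg_of_word (x ++ y).
Definition fg_inv (x : free_group) : free_group :=
  FreeGroup (word_inv_reduced (fg_wordP x)).

Lemma fg_mulA : associative fg_mul.
Proof.
by move=> x y z; apply/val_inj; rewrite /= reduce_catl reduce_catr catA.
Qed.

Lemma fg_mul1 : left_id fg_one fg_mul.
Proof. by move=> x; apply/val_inj; rewrite /= reduce_id ?fg_wordP. Qed.

Lemma fg_mulr1 : right_id fg_one fg_mul.
Proof. by move=> x; apply/val_inj; rewrite /= cats0 reduce_id ?fg_wordP. Qed.

Lemma fg_mulV : left_inverse fg_one fg_inv fg_mul.
Proof. by move=> x; apply/val_inj; rewrite /= /reduce foldr_push_inv. Qed.

Lemma word_invK : involutive word_inv.
Proof.
move=> s; rewrite /word_inv map_rev revK -map_comp.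
by rewrite map_id_in // => l _ /=; rewrite linvK.
Qed.

Lemma fg_mulrV : right_inverse fg_one fg_inv fg_mul.
Proof.
move=> x; apply/val_inj.
by rewrite /= /reduce -{1}[fg_word x]word_invK foldr_push_inv.
Qed.

HB.instance Definition _ :=
  isGroup.Build free_group fg_mulA fg_mul1 fg_mulr1 fg_mulV fg_mulrV.

Definition fg_gen (x : T) : free_group := @FreeGroup [:: (x, false)] isT.

End FreeGroup.

Section FreeLift.

Variables (T : choiceType) (G : groupType) (f : T -> G).

Definition letter_val (l : T * bool) : G := if l.2 then (f l.1)^-1 else f l.1.

Definition word_val (s : seq (T * bool)) : G :=
  foldr (fun l x => letter_val l * x) 1 s.

(* The extension of f to a group morphism. *)
Definition free_lift (x : free_group T) : G := word_val x.

Lemma letter_val_inv l : letter_val (linv l) = (letter_val l)^-1.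
Proof. by case: l => x [] /=; rewrite /letter_val /= ?invgK. Qed.

Lemma word_val_cat s1 s2 : word_val (s1 ++ s2) = word_val s1 * word_val s2.
Proof. by elim: s1 => /= [|l s1 ->]; rewrite ?mul1g ?mulgA. Qed.

Lemma word_val_push l s : word_val (push l s) = letter_val l * word_val s.
Proof.
by case: s => //= m s; case: eqP => [->|//]; rewrite letter_val_inv mulVKg.
Qed.

Lemma word_val_reduce s : word_val (reduce s) = word_val s.
Proof. by elim: s => //= l s IHs; rewrite word_val_push IHs. Qed.

Lemma free_lift_morphism : monoid_morphism free_lift.
Proof.
by split=> // x y; rewrite /free_lift word_val_reduce word_val_cat.
Qed.

HB.instance Definition _ :=
  isUMagmaMorphism.Build (free_group T) G free_lift free_lift_morphism.

Lemma free_lift_gen x : free_lift (fg_gen x) = f x.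
Proof. exact: mulg1. Qed.

End FreeLift.

Inductive normal_closure (G : groupType) (R : G -> Prop) : G -> Prop :=
| NormalClosure_sub x : R x -> normal_closure R x
| NormalClosure_one : normal_closure R 1
| NormalClosure_mul x y :
    normal_closure R x -> normal_closure R y -> normal_closure R (x * y)
| NormalClosure_inv x : normal_closure R x -> normal_closure R x^-1
| NormalClosure_conj x g : normal_closure R x -> normal_closure R (x ^ g).

(* The relators are compared by position in the list, so that a list with a
   repeated relator is not independent. *)
Definition independent (G : groupType) (rs : seq G) : Prop :=
  forall i, i < size rs ->
    ~ normal_closure
        (fun x => exists j, [/\ j < size rs, j != i & x = nth 1 rs j])
        (nth 1 rs i).

Inductive gen : Type := GenA | GenB | GenC | GenD.

Definition gen_code (g : gen) : bool * bool :=
  match g with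
  | GenA => (false, false) | GenB => (false, true)
  | GenC => (true, false) | GenD => (true, true)
  end.

Definition gen_decode (p : bool * bool) : gen :=
  match p with
  | (false, false) => GenA | (false, true) => GenB
  | (true, false) => GenC | (true, true) => GenD
  end.

Lemma gen_codeK : cancel gen_code gen_decode. Proof. by case. Qed.

HB.instance Definition _ := Countable.copy gen (can_type gen_codeK).

Definition F : groupType := free_group gen.

Definition a : F := fg_gen GenA.
Definition b : F := fg_gen GenB.
Definition c : F := fg_gen GenC.
Definition d : F := fg_gen GenD.

Definition sigma : F -> F :=
  free_lift (fun g : gen =>
    match g with
    | GenA => a * c * a
    | GenB => d
    | GenC => b
    | GenD => c
    end).

HB.instance Definition _ := UMagmaMorphism.on sigma.

Definition u (i : nat) : F := iter i sigma ((a * d) ^+ 4).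
Definition v (i : nat) : F := iter i sigma ((a * d * a * c * a * c) ^+ 4).

(* w and t are only meant for 3 <= n. *)
Definition w (n : nat) : F := iter (n - 3) sigma ((a * c) ^+ 4).
Definition t (n : nat) : F := iter (n - 3) sigma ((a * b * a * c) ^+ 4).

(* For 3 <= n: u_0, ..., u_(n-3) are n - 2 relators and v_0, ..., v_(n-4) are
   n - 3 relators. *)
Definition relators (n : nat) : seq F :=
  [:: a ^+ 2; b ^+ 2; c ^+ 2; d ^+ 2; b * c * d]
    ++ [seq u i | i <- iota 0 (n - 2)]
    ++ [seq v i | i <- iota 0 (n - 3)]
    ++ [:: w n; t n].

(* Main.v *)
(* For each relator r we produce a normal subgroup N of the free group F that
   contains the other relators but not r.  All relators except a^2, ..., bcd
   are fourth powers, so for these five the kernel of a map from F to the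
   dihedral group of order 8, which has exponent 4, does the job.  The other
   ones are treated by induction on n.  There is a morphism
   psi : F -> (F x F) wr C_2 with
     psi (sigma x) = ((phi x, phi x), (x, phi (phi x))),
   where phi F is dihedral modulo the relators, so that phi maps each relator
   to a power of z = (ad)^4.  From N one builds a normal subgroup N' that
   contains u_0 and v_0 and satisfies sigma r \in N' <-> r \in N for every
   relator r; hence if r can be separated from the other relators for n, then
   so can sigma r for n + 1.  This leaves the three long relators for n = 3,
   and u_0 and v_0 for n >= 4, which explicit permutation groups separate. *)

From HB Require Import structures.
Require Import Defs.
From mathcomp Require Import all_boot.
From Stdlib Require Import Setoid Morphisms.

Set Implicit Arguments.
Unset Strict Implicit.
Unset Printing Implicit Defensive.

Local Open Scope group_scope.

(** * Wreath products with the group of order two *)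

Section Wreath.

Variable G : groupType.

Definition wreath : Type := (G * G * bool)%type.

HB.instance Definition _ := Choice.on wreath.

Implicit Types x y : wreath.

Definition swap_if (s : bool) (p : G * G) : G * G :=
  if s then (p.2, p.1) else p.

Definition wr_one : wreath := (1, 1, false).
Definition wr_inv x : wreath := (swap_if x.2 (x.1.1^-1, x.1.2^-1), x.2).
Definition wr_mul x y : wreath :=
  let p := swap_if x.2 y.1 in
  (x.1.1 * p.1, x.1.2 * p.2, x.2 (+) y.2).

Lemma wr_mulA : associative wr_mul.
Proof.
by move=> [[x1 x2] s] [[y1 y2] [|]] [[z1 z2] r]; case: s;
  rewrite /wr_mul /= ?mulgA //; case: r.
Qed.

Lemma wr_mul1 : left_id wr_one wr_mul.
Proof. by move=> [[x1 x2] s]; rewrite /wr_mul /= !mul1g. Qed.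

Lemma wr_mulr1 : right_id wr_one wr_mul.
Proof. by move=> [[x1 x2] [|]]; rewrite /wr_mul /= !mulg1. Qed.

Lemma wr_mulV : left_inverse wr_one wr_inv wr_mul.
Proof. by move=> [[x1 x2] [|]]; rewrite /wr_mul /= !mulVg. Qed.

Lemma wr_mulrV : right_inverse wr_one wr_inv wr_mul.
Proof. by move=> [[x1 x2] [|]]; rewrite /wr_mul /= !mulgV. Qed.

HB.instance Definition _ :=
  isGroup.Build wreath wr_mulA wr_mul1 wr_mulr1 wr_mulV wr_mulrV.

End Wreath.

(** The automorphism group of the binary tree of depth [k]; the free group on no generators serves
    as the trivial group. *)
Fixpoint tree_group (k : nat) : groupType :=
  if k is k'.+1 then wreath (tree_group k') else free_group void.

(* s lists the images of 0, ..., 2 ^ k - 1 under a permutation preserving the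
   dyadic blocks; other lists give junk values. *)
Fixpoint tree_perm (k : nat) (s : seq nat) : tree_group k :=
  if k is k'.+1 then
    let h := (2 ^ k')%N in
    let r := [seq (i %% h)%N | i <- s] in
    (tree_perm k' (take h r), tree_perm k' (drop h r), (h <= head 0%N s)%N)
  else 1.

(** * Morphisms out of the free group *)

Lemma free_group_ind (T : choiceType) (P : free_group T -> Prop) :
  P 1 -> (forall l x, P x -> P (fg_gen l * x)) ->
  (forall l x, P x -> P ((fg_gen l)^-1 * x)) -> forall x, P x.
Proof.
move=> P1 Pgen PgenV; case=> s rs.
have -> : FreeGroup rs = fg_of_word s by apply/val_inj; rewrite /= reduce_id.
elim: s {rs} => [|[l e] s IHs].
  by have -> : fg_of_word [::] = fg_one T by apply/val_inj.
have -> : fg_of_word ((l, e) :: s) =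
          fg_mul (if e then fg_inv (fg_gen l) else fg_gen l) (fg_of_word s).
  by apply/val_inj; case: e => /=; rewrite (reduce_id (reduce_reduced s)).
by case: e; [apply: PgenV | apply: Pgen].
Qed.

Lemma free_hom_ext (G : groupType) (f g : UMagmaMorphism.type F G) :
  (forall l : gen, f (fg_gen l) = g (fg_gen l)) -> f =1 g.
Proof.
move=> fg; apply: free_group_ind => [|l x fgx|l x fgx].
- by rewrite !gmulf1.
- by rewrite !gmulfM fg fgx.
by rewrite !gmulfM !gmulfV fg fgx.
Qed.

Section Evaluation.

Variable G : groupType.

Definition quad : Type := (G * G * G * G)%type.

Definition quad_val (q : quad) (l : gen) : G :=
  let: (x, y, z, t) := q in
  match l with GenA => x | GenB => y | GenC => z | GenD => t end.

Definition ev (q : quad) : F -> G := free_lift (quad_val q).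

HB.instance Definition _ (q : quad) := UMagmaMorphism.on (ev q).

Definition quad_sigma (q : quad) : quad :=
  let: (x, y, z, t) := q in (x * z * x, t, y, z).

Lemma ev_gen q l : ev q (fg_gen l) = quad_val q l.
Proof. exact: free_lift_gen. Qed.

Lemma ev_sigma q x : ev q (sigma x) = ev (quad_sigma q) x.
Proof.
have := @free_hom_ext _ (ev q \o sigma) (ev (quad_sigma q)).
apply=> l /=; rewrite ev_gen.
by case: q => [[[y z] s] r]; case: l;
  rewrite /sigma free_lift_gen ?gmulfM /= /a /b /c /d !ev_gen.
Qed.

(** Iterating on the images of the generators avoids words of exponential length; for finite [G] the
    iterates are eventually periodic. *)
Lemma ev_iter_sigma q k x : ev q (iter k sigma x) = ev (iter k quad_sigma q) x.
Proof. by elim: k q => //= k IHk q; rewrite ev_sigma IHk -iterSr. Qed.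

End Evaluation.

(** * Normal subgroups and their congruences *)

Class normal_pred (G : groupType) (N : G -> Prop) : Prop := NormalPred {
  normal1 : N 1;
  normalM : forall x y, N x -> N y -> N (x * y);
  normalV : forall x, N x -> N x^-1;
  normalJ : forall x g, N x -> N (x ^ g)
}.

Arguments normal1 {G N} _.
Arguments normalM {G N} _ [x y] _ _.
Arguments normalV {G N} _ [x] _.
Arguments normalJ {G N} _ [x] g _.

Section Congruence.

Variables (G : groupType) (N : G -> Prop).
Context {nN : normal_pred N}.

Definition eqmod (x y : G) : Prop := N (x / y).

Lemma eqmod1P x : N x <-> eqmod x 1.
Proof. by rewrite /eqmod divg1. Qed.

Lemma eqmod_refl x : eqmod x x.
Proof. by rewrite /eqmod mulgV; exact: (normal1 nN). Qed.
#[local] Hint Resolve eqmod_refl : core.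

#[export] Instance eqmod_equiv : Equivalence eqmod.
Proof.
split=> [x|x y|x y z].
- exact: eqmod_refl.
- by rewrite /eqmod => Nxy; rewrite -invgF; apply: (normalV nN).
- by rewrite /eqmod => Nxy Nyz; rewrite -(divgKA y); apply: (normalM nN).
Qed.

#[export] Instance mulg_eqmod : Proper (eqmod ==> eqmod ==> eqmod) (@mul G).
Proof.
move=> x x' Nx y y' Ny; rewrite /eqmod invgM mulgA -(mulgA x y).
have -> : x * (y / y') * x'^-1 = x / x' * (y / y') ^ x'^-1.
  by rewrite conjgE invgK !mulgA mulgVK.
by apply: (normalM nN) => //; apply: (normalJ nN).
Qed.

#[export] Instance invg_eqmod : Proper (eqmod ==> eqmod) (@inv G).
Proof.
move=> x y Nxy; rewrite /eqmod invgK.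
have -> : x^-1 * y = (x / y)^-1 ^ y.
  by rewrite conjgE invgM invgK !mulgA mulVg mul1g.
by apply: (normalJ nN); apply: (normalV nN).
Qed.

#[export] Instance expg_eqmod : Proper (eqmod ==> eq ==> eqmod) (@natexp G).
Proof.
move=> x y xy n _ <-; elim: n => [|n IHn]; first by rewrite !expg0.
by rewrite !expgS IHn xy.
Qed.

#[export] Instance normal_eqmod : Proper (eqmod ==> iff) N.
Proof. by move=> x y xy; rewrite !eqmod1P xy. Qed.

End Congruence.

Arguments eqmod {G} N x y.
#[local] Hint Extern 0 (eqmod _ _ _) => reflexivity : core.

(** * The wreath recursion and its behaviour on [sigma] *)

(** The first entries of the pairs in [psi_quad] are the wreath recursion of the Grigorchuk group,
    in which [sigma x] acts as [phi x] below 0 and as [x] below 1. *)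
Definition phi : F -> F := ev (d, 1, a, a).
HB.instance Definition _ := UMagmaMorphism.on phi.

(* GenA acts as the swap; the other three values are forced by psi_sigma. *)
Definition psi_quad : quad (wreath (F * F)%type) :=
  ((1, 1, true), ((a, a), (c, d), false), ((a, a), (d, d), false),
      ((1, 1), (b, 1), false)).
Definition psi : F -> wreath (F * F)%type := ev psi_quad.
HB.instance Definition _ := UMagmaMorphism.on psi.

Lemma preim_normal (G H : groupType) (f : UMagmaMorphism.type G H) N :
  normal_pred N -> normal_pred (fun x => N (f x)).
Proof.
move=> nN; split=> [|x y Nx Ny|x Nx|x g Nx].
- by rewrite gmulf1; apply: (normal1 nN).
- by rewrite gmulfM; apply: (normalM nN).
- by rewrite gmulfV; apply: (normalV nN).
- by rewrite gmulfJ; apply: (normalJ nN).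
Qed.

Lemma normalI (G : groupType) (M N : G -> Prop) :
  normal_pred M -> normal_pred N -> normal_pred (fun x => M x /\ N x).
Proof.
move=> nM nN; split=> [|x y [Mx Nx] [My Ny]|x [Mx Nx]|x g [Mx Nx]].
- by split; [apply: (normal1 nM) | apply: (normal1 nN)].
- by split; [apply: (normalM nM) | apply: (normalM nN)].
- by split; [apply: (normalV nM) | apply: (normalV nN)].
- by split; [apply: (normalJ nM) | apply: (normalJ nN)].
Qed.

Definition zeta : F := (a * d) ^+ 4.

Lemma phi_gen l : phi (fg_gen l) = quad_val (d, 1, a, a) l.
Proof. exact: ev_gen. Qed.

(** * The dihedral image of [phi] *)

Section Dihedral.

Variable M : F -> Prop.
Context {nM : normal_pred M}.
Hypotheses (Ma2 : M (a ^+ 2)) (Md2 : M (d ^+ 2)) (Mz2 : M (zeta ^+ 2)).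

Let r : F := a * d.

Let aa : eqmod M (a * a) 1. Proof. by rewrite -eqmod1P; exact: Ma2. Qed.
Let dd : eqmod M (d * d) 1. Proof. by rewrite -eqmod1P; exact: Md2. Qed.
Let r8 : eqmod M (r ^+ 8) 1.
Proof. by rewrite -eqmod1P (expgnA r 4 2). Qed.
Let aV : eqmod M a^-1 a.
Proof. by rewrite -[a^-1]mulg1 -aa mulKg. Qed.
Let dV : eqmod M d^-1 d.
Proof. by rewrite -[d^-1]mulg1 -dd mulKg. Qed.

(** This is $a r^k = r^{-k} a$: modulo [M], $r^7$ is the inverse of [r], which keeps exponents
    natural. *)
Let ar k : eqmod M (a * r ^+ k) (r ^+ (7 * k) * a).
Proof.
elim: k => [|k IHk]; first by rewrite muln0 !expg0 mulg1 mul1g.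
have r7 : eqmod M (r ^+ 7) (d * a).
  by rewrite -[r ^+ 7](mulgK r) -expgSr r8 mul1g /r invgM dV aV.
have -> : (7 * k.+1 = 7 * k + 7)%N by rewrite mulnS addnC.
rewrite expgSr mulgA IHk (expgnDr r (7 * k) 7) -(mulgA _ a) r7 /r.
by rewrite !mulgA -(mulgA _ a a) aa mulg1 -(mulgA _ a a) aa mulg1.
Qed.

Let dihedral x : Prop := exists k (e : bool), eqmod M x (r ^+ k * a ^+ e).

Let dihedral_a x : dihedral x -> dihedral (a * x).
Proof.
case=> k [e xE]; exists (7 * k)%N, (~~ e); rewrite xE mulgA ar -mulgA.
by case: e {xE} => /=; rewrite ?expg0 ?expg1 ?mulg1 ?aa ?mulg1.
Qed.

(** Modulo [M], $d = a r$. *)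
Let dihedral_d x : dihedral x -> dihedral (d * x).
Proof.
move=> dx; have [k [e axE]] : dihedral (a * (r * x)).
  apply: dihedral_a; case: dx => k [e xE]; exists k.+1, e.
  by rewrite xE expgS mulgA.
by exists k, e; rewrite -axE /r !mulgA aa mul1g.
Qed.

Let phi_dihedral x : dihedral (phi x).
Proof.
elim/free_group_ind: x => [|l x IHx|l x IHx].
- by exists 0%N, false; rewrite gmulf1 !expg0 mulg1.
- rewrite gmulfM /= phi_gen; case: l.
  + exact: dihedral_d.
  + by rewrite /= mul1g.
  + exact: dihedral_a.
  + exact: dihedral_a.
have eq_dihedral y y' : eqmod M y y' -> dihedral y' -> dihedral y.
  by move=> yy' [k [e y'E]]; exists k, e; rewrite yy'.
rewrite gmulfM gmulfV /= phi_gen; case: l.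
- by apply: (eq_dihedral _ (d * phi x)) (dihedral_d IHx); rewrite dV.
- by rewrite /= invg1 mul1g.
- by apply: (eq_dihedral _ (a * phi x)) (dihedral_a IHx); rewrite aV.
- by apply: (eq_dihedral _ (a * phi x)) (dihedral_a IHx); rewrite aV.
Qed.

(** A reflection squares to 1 modulo [M]; a rotation $r^k$ has fourth power $\zeta^k$, where only
    the parity of $k$ matters. *)
Lemma phi_exp4 x : exists i : bool, M (phi x ^+ 4 * zeta ^+ i).
Proof.
have [k [[] xE]] := phi_dihedral x.
  exists false; rewrite expg0 mulg1 eqmod1P.
  have x2 : eqmod M (phi x ^+ 2) 1.
    rewrite expgS expg1 xE expg1 -mulgA (mulgA a) ar -mulgA aa mulg1.
    by rewrite -expgnDr -mulSn expgnA r8 expg1n.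
  by rewrite (expgnA _ 2 2) x2 expg1n.
exists (odd k); rewrite eqmod1P xE expg0 mulg1 -expgnA mulnC expgnA -/zeta.
rewrite -expgnDr -{1}(odd_double_half k) addnAC addnn -doubleD -mul2n expgnA.
have -> : eqmod M (zeta ^+ 2) 1 by apply/eqmod1P.
by rewrite expg1n.
Qed.

End Dihedral.

(** * Cosets of a central involution modulo [N] *)

Section CentralCosets.

Variables (G : groupType) (N : G -> Prop) (z : G).
Context {nN : normal_pred N}.
Hypotheses (Nz2 : N (z ^+ 2)) (Nzg : forall g, N [~ z, g]).

(** The coset $z^i N$, since $z^i$ is its own inverse modulo [N]. *)
Definition in_coset (i : bool) (x : G) : Prop := N (x * z ^+ i).

(* z = (ad)^4 is only central modulo N, not in N, when u_0 itself is to be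
   separated.  For a relator r in z^k N with phi r in z^i N, the image of
   sigma r under psi lies in ((z^i, z^i), (z^k, z^i)) N^4; the parity condition
   reads k = 0 there, and it defines a subgroup invariant under the swap. *)
Definition lift_kernel (p : wreath (G * G)%type) : Prop :=
  p.2 = false /\ exists i j k : bool,
    [/\ k = i (+) j, in_coset i p.1.1.1, in_coset j p.1.1.2,
        in_coset k p.1.2.1 & in_coset j p.1.2.2].

Let zz : eqmod N (z * z) 1. Proof. by rewrite -eqmod1P; exact: Nz2. Qed.

Let zg g : eqmod N (z * g) (g * z).
Proof.
have E : eqmod N [~ z, g] 1 by rewrite -eqmod1P.
by rewrite commgC E mulg1.
Qed.

Let zig (i : bool) g : eqmod N (z ^+ i * g) (g * z ^+ i).
Proof. by case: i; rewrite ?expg1 ?expg0 ?mul1g ?mulg1 ?zg. Qed.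

Let zij (i j : bool) : eqmod N (z ^+ i * z ^+ j) (z ^+ (i (+) j)).
Proof. by case: i; case: j; rewrite /= ?expg1 ?expg0 ?mul1g ?mulg1 ?zz. Qed.

Let zii (i : bool) : eqmod N (z ^+ i * z ^+ i) 1.
Proof. by rewrite zij addbb. Qed.

Let in_cosetE i x : in_coset i x <-> eqmod N x (z ^+ i).
Proof.
rewrite /in_coset eqmod1P; split=> E.
  by rewrite -[x]mulg1 -(zii i) mulgA E mul1g.
by rewrite E zii.
Qed.

Lemma in_coset0 x : in_coset false x = N x.
Proof. by rewrite /in_coset mulg1. Qed.

Let in_coset1 : in_coset false 1.
Proof. by rewrite /in_coset mulg1; exact: (normal1 nN). Qed.

Let in_cosetM i j x y :
  in_coset i x -> in_coset j y -> in_coset (i (+) j) (x * y).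
Proof. by rewrite !in_cosetE => -> ->; rewrite zij. Qed.

Let in_cosetV i x : in_coset i x -> in_coset i x^-1.
Proof.
rewrite !in_cosetE => ->.
by rewrite -[_^-1]mulg1 -(zii i) mulKg.
Qed.

Let in_cosetJ i x g : in_coset i x -> in_coset i (x ^ g).
Proof. by rewrite !in_cosetE conjgE => ->; rewrite zig mulKg. Qed.

(** Replaces uniqueness of the index, which fails when [z] lies in [N]. *)
Lemma in_coset_inj i j x : in_coset i x -> in_coset j x -> N (z ^+ (i (+) j)).
Proof. by rewrite !in_cosetE => Ei Ej; rewrite eqmod1P -zij -Ei Ej zii. Qed.

Lemma conjg_central g : eqmod N (z ^ g) z.
Proof. by rewrite conjgE zg mulKg. Qed.

Lemma lift_kernel_normal : normal_pred lift_kernel.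
Proof.
split.
- by split=> //; exists false, false, false; split=> //=; exact: in_coset1.
- move=> [[[x1 x2] [x3 x4]] s] [[[y1 y2] [y3 y4]] t].
  move=> [/= -> [i [j [k [-> C1 C2 C3 C4]]]]].
  move=> [/= -> [i' [j' [k' [-> D1 D2 D3 D4]]]]]; split=> //=.
  exists (i (+) i'), (j (+) j'), ((i (+) j) (+) (i' (+) j')).
  by split; [rewrite addbACA | apply: in_cosetM ..].
- move=> [[[x1 x2] [x3 x4]] s] [/= -> [i [j [k [kE C1 C2 C3 C4]]]]].
  by split=> //=; exists i, j, k; split=> //; apply: in_cosetV.
move=> [[[x1 x2] [x3 x4]] s] [[[y1 y2] [y3 y4]] t].
move=> [/= -> [i [j [k [kE C1 C2 C3 C4]]]]].
case: t; split=> //=.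
  (* The swap exchanges the index pairs $(i,j)$ and $(k,j)$, and $k = i + j$ is equivalent to $i = k
     + j$ modulo 2. *)
  exists k, j, i; split; try exact: in_cosetJ.
  by rewrite kE -addbA addbb addbF.
by exists i, j, k; split=> //; apply: in_cosetJ.
Qed.

Lemma lift_kernel0 (p : wreath (G * G)%type) :
  p.2 = false -> N p.1.1.1 -> N p.1.1.2 -> N p.1.2.1 -> N p.1.2.2 ->
  lift_kernel p.
Proof.
move=> p2 N1 N2 N3 N4; split=> //; exists false, false, false.
by split; rewrite ?in_coset0.
Qed.

End CentralCosets.

(** * Pulling a normal subgroup back along [psi] *)

Definition basics : seq F := [:: a ^+ 2; b ^+ 2; c ^+ 2; d ^+ 2; b * c * d].

Definition psi_sigma_image (x : F) : wreath (F * F)%type :=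
  ((phi x, phi x), (x, phi (phi x)), false).

Lemma psi_sigma_image_morphism : monoid_morphism psi_sigma_image.
Proof.
by split=> [|x y]; rewrite /psi_sigma_image /= ?gmulf1 ?gmulfM ?gmulf1 ?gmulfM.
Qed.

HB.instance Definition _ :=
  isUMagmaMorphism.Build F _ psi_sigma_image psi_sigma_image_morphism.

Lemma psi_sigma x : psi (sigma x) = psi_sigma_image x.
Proof.
rewrite /psi ev_sigma; apply: (free_hom_ext (f := ev _) (g := psi_sigma_image)).
by move=> l; apply/eqP; case: l; vm_compute.
Qed.

Section Lift.

Variable N : F -> Prop.
Context {nN : normal_pred N}.
Hypotheses (N_basics : {in basics, forall x, N x}).
Hypotheses (Nz2 : N (zeta ^+ 2)) (Nzg : forall g, N [~ zeta, g]).

Definition lift_pred (x : F) : Prop := lift_kernel N zeta (psi x).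

Lemma lift_pred_normal : normal_pred lift_pred.
Proof.
exact (preim_normal psi (lift_kernel_normal Nz2 Nzg)).
Qed.

Let N_a2 : N (a ^+ 2). Proof. by apply: N_basics. Qed.
Let N_b2 : N (b ^+ 2). Proof. by apply: N_basics. Qed.
Let N_c2 : N (c ^+ 2). Proof. by apply: N_basics. Qed.
Let N_d2 : N (d ^+ 2). Proof. by apply: N_basics. Qed.
Let N_bcd : N (b * c * d). Proof. by apply: N_basics. Qed.

Lemma lift_pred_psi x p :
  psi x = p -> p.2 = false ->
  N p.1.1.1 -> N p.1.1.2 -> N p.1.2.1 -> N p.1.2.2 -> lift_pred x.
Proof. by rewrite /lift_pred => -> *; apply: lift_kernel0. Qed.

Lemma lift_basics : {in basics, forall x, lift_pred x}.
Proof.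
have N_cdb : N (c * d * b).
  have -> : c * d * b = (b * c * d) ^ b by rewrite conjgE !mulgA mulVg mul1g.
  exact: (normalJ nN).
have N1 := normal1 nN.
have psi_a2 : psi (a ^+ 2) = ((1, 1), (1, 1), false) by apply/eqP; vm_compute.
have psi_b2 : psi (b ^+ 2) = ((a ^+ 2, a ^+ 2), (c ^+ 2, d ^+ 2), false).
  by apply/eqP; vm_compute.
have psi_c2 : psi (c ^+ 2) = ((a ^+ 2, a ^+ 2), (d ^+ 2, d ^+ 2), false).
  by apply/eqP; vm_compute.
have psi_d2 : psi (d ^+ 2) = ((1, 1), (b ^+ 2, 1), false).
  by apply/eqP; vm_compute.
have psi_bcd : psi (b * c * d) = ((a ^+ 2, a ^+ 2), (c * d * b, d ^+ 2), false).
  by apply/eqP; vm_compute.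
move=> x; rewrite !inE => /or4P[/eqP->|/eqP->|/eqP->|/orP[/eqP->|/eqP->]].
- exact: lift_pred_psi psi_a2 _ _ _ _ _.
- exact: lift_pred_psi psi_b2 _ _ _ _ _.
- exact: lift_pred_psi psi_c2 _ _ _ _ _.
- exact: lift_pred_psi psi_d2 _ _ _ _ _.
exact: lift_pred_psi psi_bcd _ _ _ _ _.
Qed.

Lemma lift_u0 : lift_pred ((a * d) ^+ 4).
Proof.
have N1 := normal1 nN.
have psi_u0 : psi ((a * d) ^+ 4) = ((b ^+ 2, 1), (b ^+ 2, 1), false).
  by apply/eqP; vm_compute.
exact: lift_pred_psi psi_u0 _ _ _ _ _.
Qed.

Lemma lift_v0 : lift_pred ((a * d * a * c * a * c) ^+ 4).
Proof.
(* Modulo $a^2$ and $d^2$, the elements squared here are $b$, 1, a conjugate of $b$, and 1. *)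
have psi_v0 : psi ((a * d * a * c * a * c) ^+ 4) =
    (((b * a * (d * d) * a) ^+ 2, (a * (d * d) * a) ^+ 2),
     ((d * (a * (b * (a * d)))) ^+ 2, (d * (a * a) * d) ^+ 2), false).
  by apply/eqP; vm_compute.
have aa : eqmod N (a * a) 1 by rewrite -eqmod1P; exact: N_a2.
have bb : eqmod N (b * b) 1 by rewrite -eqmod1P; exact: N_b2.
have dd : eqmod N (d * d) 1 by rewrite -eqmod1P; exact: N_d2.
apply: lift_pred_psi psi_v0 _ _ _ _ _ => //; cbn [fst snd].
- by rewrite eqmod1P dd mulg1 -(mulgA b) aa mulg1; exact: bb.
- by rewrite eqmod1P dd mulg1 aa expg1n.
- rewrite eqmod1P expgS expg1 !mulgA -(mulgA _ d d) dd mulg1 -(mulgA _ a a) aa.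
  by rewrite mulg1 -(mulgA _ b b) bb mulg1 -(mulgA _ a a) aa mulg1.
- by rewrite eqmod1P aa mulg1 dd expg1n.
Qed.

(** Two coordinates of the image are $\phi(x^4)$, so their indices agree up to powers of [zeta] in
    [N]; the parity condition then puts $x^4$ in [N]. *)
Lemma lift_sigma_exp4 x : lift_pred (sigma (x ^+ 4)) <-> N (x ^+ 4).
Proof.
(* Working modulo [M] gives one exponent [i] valid for both $\phi(x^4)$ and $\phi(\phi(x^4))$. *)
pose M y := N y /\ N (phi y).
have nM : normal_pred M := normalI nN (preim_normal phi nN).
have Ma2 : M (a ^+ 2).
  have phi2 : phi (a ^+ 2) = d ^+ 2 by apply/eqP; vm_compute.
  by split=> //; rewrite phi2.
have Md2 : M (d ^+ 2).
  have phi2 : phi (d ^+ 2) = a ^+ 2 by apply/eqP; vm_compute.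
  by split=> //; rewrite phi2.
(* Indeed $\phi(ad) = da = (ad)^a$, so [phi] fixes [zeta] modulo [N]. *)
have phi_zeta : phi zeta = zeta ^ a by apply/eqP; vm_compute.
have Mz2 : M (zeta ^+ 2).
  by split=> //; rewrite gmulfXn /= phi_zeta -conjXg; apply: (normalJ nN).
have [i [Ni Npi]] := phi_exp4 Ma2 Md2 Mz2 x.
have C1 : in_coset N zeta i (phi (x ^+ 4)) by rewrite gmulfXn.
have C2 : in_coset N zeta i (phi (phi (x ^+ 4))).
  have phi_zetaX : phi (zeta ^+ i) = (zeta ^ a) ^+ i.
    by case: (i); rewrite ?expg1 ?expg0 ?gmulf1.
  move: Npi; rewrite /in_coset gmulfM /= phi_zetaX !gmulfXn /=.
  by rewrite (conjg_central Nzg a).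
rewrite /lift_pred psi_sigma; split=> [[_ [i' [j' [k [/= kE D1 D2 D3 _]]]]]|Nx].
  have Nzk : N (zeta ^+ k) by rewrite kE; exact: (in_coset_inj Nz2 D1 D2).
  rewrite -[x ^+ 4](mulgK (zeta ^+ k)).
  exact: (normalM nN) D3 (normalV nN Nzk).
by split=> //; exists i, i, false; split; rewrite ?addbb ?in_coset0.
Qed.

End Lift.

(** * Indices of the long relators and the induction step *)

Inductive rel_index : Type := IndexU of nat | IndexV of nat | IndexW | IndexT.

Definition valid_index (n : nat) (r : rel_index) : bool :=
  match r with
  | IndexU i => (i < n - 2)%N
  | IndexV i => (i < n - 3)%N
  | _ => true
  end.

Definition rel_level (n : nat) (r : rel_index) : nat :=
  match r with IndexU i | IndexV i => i | _ => (n - 3)%N end.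

Definition rel_root (r : rel_index) : F :=
  match r with
  | IndexU _ => a * d
  | IndexV _ => a * d * a * c * a * c
  | IndexW => a * c
  | IndexT => a * b * a * c
  end.

Definition relator (n : nat) (r : rel_index) : F :=
  iter (rel_level n r) sigma (rel_root r ^+ 4).

Lemma iter_sigmaX k x m : iter k sigma (x ^+ m) = iter k sigma x ^+ m.
Proof. by elim: k => //= k ->; rewrite gmulfXn. Qed.

(* The last condition is automatic unless x = IndexU 0, since zeta = u 0. *)
Definition separates (n : nat) (x : rel_index) (N : F -> Prop) : Prop :=
  [/\ normal_pred N, {in basics, forall y, N y},
      forall y, valid_index n y -> y <> x -> N (relator n y),
      ~ N (relator n x)
    & N (zeta ^+ 2) /\ forall g, N [~ zeta, g]].

(** [IndexW] and [IndexT] stay fixed because their level already grows with [n]. *)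
Definition succ_index (x : rel_index) : rel_index :=
  match x with
  | IndexU i => IndexU i.+1
  | IndexV i => IndexV i.+1
  | _ => x
  end.

Lemma relator_succ n x :
  (3 <= n)%N -> relator n.+1 (succ_index x) = sigma (relator n x).
Proof. by move=> n3; case: x => [i|i||] //=; rewrite /relator /= subSn. Qed.

Lemma valid_indexS n x : (3 <= n)%N -> valid_index n.+1 x ->
  [\/ x = IndexU 0, x = IndexV 0 |
      exists2 y, valid_index n y & x = succ_index y].
Proof.
move=> n3; case: x => [[|i]|[|i]||] /=.
- by constructor 1.
- move=> ilt; constructor 3; exists (IndexU i) => //=.
  by rewrite -ltnS -subSn // ltnW.
- by constructor 2.
- move=> ilt; constructor 3; exists (IndexV i) => //=.
  by rewrite -ltnS -subSn.
- by constructor 3; exists IndexW.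
by constructor 3; exists IndexT.
Qed.

(** The lifted subgroup contains [zeta] itself, which settles $u_0$ and renews the centrality
    condition for the next step. *)
Lemma separates_lift n x N :
  (3 <= n)%N -> separates n x N -> separates n.+1 (succ_index x) (lift_pred N).
Proof.
move=> n3 [nN N_basics N_others N_x [Nz2 Nzg]].
have nL : normal_pred (lift_pred N) by exact: lift_pred_normal Nz2 Nzg.
have lift_relator y :
    lift_pred N (relator n.+1 (succ_index y)) <-> N (relator n y).
  by rewrite relator_succ // /relator iter_sigmaX; apply: lift_sigma_exp4.
have Lz : lift_pred N zeta by exact: lift_u0 N_basics.
split; first exact: nL.
- exact: lift_basics N_basics.
- move=> y /(valid_indexS n3)[->|->|[y' y'v ->]] yx; first exact: Lz.
    exact: lift_v0 N_basics.
  by apply/lift_relator; apply: N_others => // y'x; apply: yx; rewrite y'x.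
- by rewrite lift_relator.
split; first exact: (normalM nL Lz Lz).
move=> g; rewrite commgEl.
by apply: (normalM nL); [apply: normalV | apply: normalJ].
Qed.

(** * Separation by explicit finite groups *)

Section EvaluationKernels.

Variables (G : groupType) (q : quad G).

Definition ev_trivial : F -> Prop := fun x => ev q x = 1.

Lemma ev_trivial_normal : normal_pred ev_trivial.
Proof.
rewrite /ev_trivial; split=> [|x y Nx Ny|x Nx|x g Nx].
- by rewrite gmulf1.
- by rewrite gmulfM /= Nx Ny mulg1.
- by rewrite gmulfV /= Nx invg1.
- by rewrite gmulfJ /= Nx conj1g.
Qed.

(** Centrality of the image of [zeta] is tested on the generators only. *)
Lemma ev_separates n x :
  all (fun y => ev q y == 1) basics ->
  (forall y, valid_index n y -> y <> x -> ev q (relator n y) = 1) ->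
  ev q (relator n x) != 1 ->
  ev q (zeta ^+ 2) == 1 ->
  all (fun g => ev q [~ zeta, g] == 1) [:: a; b; c; d] ->
  separates n x ev_trivial.
Proof.
move=> /allP q_basics q_others /eqP q_x /eqP qz2 /allP qzg.
split=> //; first exact: ev_trivial_normal.
- by move=> y /q_basics/eqP.
split=> // g; rewrite /ev_trivial.
have qzgl l : commute (ev q zeta) (ev q (fg_gen l)).
  by apply/commgP; rewrite -gmulfR; apply: qzg; case: l.
rewrite gmulfR /=; apply/eqP/commgP; move: (ev q zeta) qzgl => w qwl.
elim/free_group_ind: g => [|l y IHy|l y IHy].
- by rewrite gmulf1; apply: commute1.
- by rewrite gmulfM; apply: commuteM => //; apply: qwl.
by rewrite gmulfM gmulfV; apply: commuteM => //; apply: commuteV; apply: qwl.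
Qed.

(** [rel_root] ignores the number in [IndexU] and [IndexV], so the zeros stand for all values. *)
Definition kills_exp4 (p : quad G) : bool :=
  all (fun x => ev p (x ^+ 4) == 1)
    [seq rel_root x | x <- [:: IndexU 0; IndexV 0; IndexW; IndexT]].

Lemma ev_relator n x : ev q (relator n x) =
  ev (iter (rel_level n x) (@quad_sigma G) q) (rel_root x ^+ 4).
Proof. exact: ev_iter_sigma. Qed.

(** The orbit of [quad_sigma q] closes up within [m] steps, so finitely many checks cover every
    positive level. *)
Lemma ev_relator_trivial n x m :
  looping (@quad_sigma G) (quad_sigma q) m ->
  all kills_exp4 (traject (@quad_sigma G) (quad_sigma q) m) ->
  (0 < rel_level n x)%N -> ev q (relator n x) = 1.
Proof.
move=> /loopingP q_loop /allP q_kills; rewrite ev_relator.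
case: (rel_level n x) => // k _; rewrite iterSr.
have /allP q_k := q_kills _ (q_loop k); apply/eqP.
by case: x => [i|i||]; apply: (q_k (rel_root _)); rewrite !inE ?eqxx ?orbT.
Qed.

End EvaluationKernels.

(* Let M = F_2^4 with basis the vertices b, b^a, b^(ada), b^(ad) of a square on
   which <a, d> acts as the dihedral group D of order 8.  A D-invariant bilinear
   form on M x M gives a central extension of M x M by Z/2, hence of
   (M x M) : D : C_2, generated by images of a, b, c, d as in psi_quad.  The
   invariant forms are spanned by two; among the u_i and v_i, one of them
   violates only u_0 and the other only v_0.  quad_u and quad_v are the actions
   of these extensions on the cosets of subgroups of index 32 that contain the
   radicals of the forms, which makes the w_n and t_n with n >= 4 trivial.  The
   quads of degree 8 and 16 were found by a random search. *)
Definition quad_u : quad (tree_group 5) :=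
  (tree_perm 5 [:: 16; 17; 18; 19; 20; 21; 22; 23; 24; 25; 26; 27; 31; 30;
     28; 29; 0; 1; 2; 3; 4; 5; 6; 7; 8; 9; 10; 11; 14; 15; 13; 12],
   tree_perm 5 [:: 8; 9; 10; 11; 12; 13; 14; 15; 0; 1; 2; 3; 4; 5; 6; 7; 17;
     16; 18; 19; 21; 20; 22; 23; 28; 29; 30; 31; 24; 25; 26; 27],
   tree_perm 5 [:: 2; 3; 0; 1; 4; 5; 6; 7; 10; 11; 8; 9; 12; 13; 14; 15; 20;
     21; 22; 23; 16; 17; 18; 19; 25; 24; 27; 26; 29; 28; 31; 30],
   tree_perm 5 [:: 10; 11; 8; 9; 12; 13; 14; 15; 2; 3; 0; 1; 4; 5; 6; 7; 21;
     20; 22; 23; 17; 16; 18; 19; 29; 28; 31; 30; 25; 24; 27; 26])%N.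

Definition quad_v : quad (tree_group 5) :=
  (tree_perm 5 [:: 2; 3; 0; 1; 4; 5; 7; 6; 8; 9; 11; 10; 15; 14; 13; 12; 24;
     25; 26; 27; 28; 29; 30; 31; 16; 17; 18; 19; 20; 21; 22; 23],
   tree_perm 5 [:: 16; 17; 18; 19; 20; 21; 22; 23; 24; 25; 26; 27; 28; 29;
     30; 31; 0; 1; 2; 3; 4; 5; 6; 7; 8; 9; 10; 11; 12; 13; 14; 15],
   tree_perm 5 [:: 1; 0; 2; 3; 4; 5; 7; 6; 12; 13; 14; 15; 8; 9; 10; 11; 17;
     16; 18; 19; 20; 21; 23; 22; 28; 29; 30; 31; 24; 25; 26; 27],
   tree_perm 5 [:: 17; 16; 18; 19; 20; 21; 23; 22; 28; 29; 30; 31; 24; 25;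
     26; 27; 1; 0; 2; 3; 4; 5; 7; 6; 12; 13; 14; 15; 8; 9; 10; 11])%N.

Definition quad3_u : quad (tree_group 3) :=
  (tree_perm 3 [:: 2; 3; 0; 1; 5; 4; 6; 7],
   tree_perm 3 [:: 7; 6; 5; 4; 3; 2; 1; 0],
   tree_perm 3 [:: 1; 0; 2; 3; 4; 5; 7; 6],
   tree_perm 3 [:: 6; 7; 5; 4; 3; 2; 0; 1])%N.

Definition quad3_w : quad (tree_group 3) :=
  (tree_perm 3 [:: 6; 7; 4; 5; 2; 3; 0; 1],
   tree_perm 3 [:: 0; 1; 2; 3; 7; 6; 5; 4],
   tree_perm 3 [:: 1; 0; 2; 3; 7; 6; 5; 4],
   tree_perm 3 [:: 1; 0; 2; 3; 4; 5; 6; 7])%N.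

Definition quad3_t : quad (tree_group 4) :=
  (tree_perm 4 [:: 0; 1; 2; 3; 4; 5; 6; 7; 10; 11; 8; 9; 13; 12; 14; 15],
   tree_perm 4 [:: 6; 7; 4; 5; 2; 3; 0; 1; 14; 15; 12; 13; 10; 11; 8; 9],
   tree_perm 4 [:: 12; 13; 15; 14; 9; 8; 10; 11; 5; 4; 6; 7; 0; 1; 3; 2],
   tree_perm 4 [:: 10; 11; 9; 8; 15; 14; 12; 13; 3; 2; 0; 1; 6; 7; 5; 4])%N.

Lemma separates_base x :
  valid_index 3 x -> exists N, separates 3 x N.
Proof.
have valid3 y : valid_index 3 y -> [\/ y = IndexU 0, y = IndexW | y = IndexT].
  case: y => [[|i]|i||] // _.
  - by constructor 1.
  - by constructor 2.
  by constructor 3.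
case/valid3=> ->.
- exists (ev_trivial quad3_u); apply: ev_separates;
  [by vm_compute | | by vm_compute ..].
  by move=> y /valid3[->|->|->] // _; apply/eqP; vm_compute.
- exists (ev_trivial quad3_w); apply: ev_separates;
  [by vm_compute | | by vm_compute ..].
  by move=> y /valid3[->|->|->] // _; apply/eqP; vm_compute.
- exists (ev_trivial quad3_t); apply: ev_separates;
  [by vm_compute | | by vm_compute ..].
  by move=> y /valid3[->|->|->] // _; apply/eqP; vm_compute.
Qed.

(** For $n \ge 4$ the only relators of level 0 are $u_0$ and $v_0$. *)
Lemma separates_u0 n : (4 <= n)%N -> exists N, separates n (IndexU 0) N.
Proof.
move=> n4; exists (ev_trivial quad_u).
apply: ev_separates; [by vm_compute | | by vm_compute ..].
move=> y _ yx; have [y0|] := posnP (rel_level n y); last first.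
  (* Seven steps suffice for the orbit of quadruples to close up. *)
  by apply: (@ev_relator_trivial _ _ _ _ 7); vm_compute.
case: y y0 yx => [i|i||] /= y0 yx.
- by case: yx; rewrite y0.
- by rewrite y0; apply/eqP; vm_compute.
- by move/eqP: y0; rewrite subn_eq0 leqNgt n4.
by move/eqP: y0; rewrite subn_eq0 leqNgt n4.
Qed.

Lemma separates_v0 n : (4 <= n)%N -> exists N, separates n (IndexV 0) N.
Proof.
move=> n4; exists (ev_trivial quad_v).
apply: ev_separates; [by vm_compute | | by vm_compute ..].
move=> y _ yx; have [y0|] := posnP (rel_level n y); last first.
  by apply: (@ev_relator_trivial _ _ _ _ 7); vm_compute.
case: y y0 yx => [i|i||] /= y0 yx.
- by rewrite y0; apply/eqP; vm_compute.
- by case: yx; rewrite y0.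
- by move/eqP: y0; rewrite subn_eq0 leqNgt n4.
by move/eqP: y0; rewrite subn_eq0 leqNgt n4.
Qed.

Lemma separates_exists n x :
  (3 <= n)%N -> valid_index n x -> exists N, separates n x N.
Proof.
move=> n3; elim: n n3 x => // n IHn; rewrite leq_eqVlt => /orP[/eqP<-|n3] x.
  exact: separates_base.
case/(valid_indexS n3)=> [->|->|[y yv ->]].
- exact: separates_u0.
- exact: separates_v0.
by have [N sepN] := IHn n3 y yv; exists (lift_pred N); apply: separates_lift.
Qed.

(** * Dihedral quotients for the five short relators *)

(** A rotation and two reflections of the square with vertices 0, 2, 1, 3 in cyclic order. *)
Definition cycle4 : tree_group 2 := tree_perm 2 [:: 2; 3; 1; 0]%N.
Definition refl4 : tree_group 2 := tree_perm 2 [:: 1; 0; 2; 3]%N.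
Definition flip4 : tree_group 2 := tree_perm 2 [:: 2; 3; 0; 1]%N.

(* The i-th quad violates only the i-th entry of basics. *)
Definition basic_quads : seq (quad (tree_group 2)) :=
  [:: (cycle4, 1, 1, 1);
      (1, (refl4 * flip4)^-1, refl4, flip4);
      (1, refl4, refl4 * flip4, flip4);
      (1, refl4, flip4, (refl4 * flip4)^-1);
      (1, 1, 1, refl4)].

Lemma free_group_void (x : free_group void) : x = fg_one void.
Proof. by apply/val_inj; case: x => -[|[[]]]. Qed.

Lemma tree_group2_exp4 (x : tree_group 2) : x ^+ 4 = 1.
Proof.
case: x => [[[[x1 x2] s] [[y1 y2] t]] r].
rewrite (free_group_void x1) (free_group_void x2).
rewrite (free_group_void y1) (free_group_void y2).
by apply/eqP; case: s; case: t; case: r; vm_compute.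
Qed.

Lemma basic_separated i : (i < 5)%N ->
  exists N : F -> Prop, [/\ normal_pred N,
    forall j, (j < 5)%N -> j <> i -> N (nth 1 basics j),
    forall x, N (x ^+ 4) & ~ N (nth 1 basics i)].
Proof.
move=> i5; pose q k := nth (1, 1, 1, 1) basic_quads k.
have /allP/(_ i) : all (fun k => (ev (q k) (nth 1 basics k) != 1) &&
    all (fun j => (j == k) || (ev (q k) (nth 1 basics j) == 1)) (iota 0 5))
  (iota 0 5) by vm_compute.
rewrite mem_iota => /(_ i5)/andP[/eqP q_i /allP q_others].
exists (ev_trivial (q i)); split=> //.
- exact: ev_trivial_normal.
- move=> j j5 /eqP ji; apply/eqP.
  by have := q_others j; rewrite mem_iota (negPf ji) => /(_ j5).
by move=> x; rewrite /ev_trivial gmulfXn; apply: tree_group2_exp4.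
Qed.

(** * Positions in the list and conclusion *)

Definition index_pos (n : nat) (x : rel_index) : nat :=
  match x with
  | IndexU i => 5 + i
  | IndexV i => 5 + (n - 2) + i
  | IndexW => 5 + (n - 2) + (n - 3)
  | IndexT => (5 + (n - 2) + (n - 3)).+1
  end.

Lemma nth_relators n j : (j < size (relators n))%N ->
  (j < 5)%N /\ nth 1 (relators n) j = nth 1 basics j \/
  exists x, [/\ valid_index n x, j = index_pos n x
              & nth 1 (relators n) j = relator n x].
Proof.
rewrite /relators -/basics !size_cat !size_map !size_iota nth_cat.
rewrite -[size basics]/5%N => jlt; case: ltnP => [j5|j5]; [by left | right].
rewrite nth_cat size_map size_iota.
case: ltnP => [ju|ju].
  exists (IndexU (j - 5)); rewrite /= ju subnKC //; split=> //.
  by rewrite (nth_map 0%N) ?size_iota // nth_iota.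
rewrite nth_cat size_map size_iota.
case: ltnP => [jv|jv].
  exists (IndexV (j - 5 - (n - 2))); rewrite /= jv; split=> //.
    by rewrite -addnA subnKC ?subnKC.
  by rewrite (nth_map 0%N) ?size_iota // nth_iota.
have : (j - 5 - (n - 2) - (n - 3) < 2)%N.
  by rewrite !ltn_subLR.
have : j = 5 + (n - 2) + (n - 3) + (j - 5 - (n - 2) - (n - 3)).
  by rewrite -!addnA !subnKC.
(* The remaining offset is 0 for $w_n$ and 1 for $t_n$. *)
case: (_ - (n - 3))%N => [|[|k]] // jE _; [exists IndexW | exists IndexT];
  split=> //.
  exact: etrans jE (addn0 _).
exact: etrans jE (addn1 _).
Qed.

Lemma normal_closure_sub (G : groupType) (R N : G -> Prop) :
  normal_pred N -> (forall x, R x -> N x) ->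
  forall x, normal_closure R x -> N x.
Proof.
move=> nN RN x; elim=> {x} [x /RN //||x y _ Nx _ Ny|x _ Nx|x g _ Nx].
- exact: (normal1 nN).
- exact: (normalM nN).
- exact: (normalV nN).
exact: (normalJ nN).
Qed.

Theorem theorem3 (n : nat) (hn : 3 <= n) : independent (relators n).
Proof.
move=> i ilt.
suff [N [nN N_others N_i]] : exists N : F -> Prop, [/\ normal_pred N,
    forall j, (j < size (relators n))%N -> j <> i -> N (nth 1 (relators n) j)
    & ~ N (nth 1 (relators n) i)].
  move=> cl_i; apply: N_i.
  apply: normal_closure_sub cl_i => // _ [j [jlt ji ->]].
  by apply: N_others => //; apply/eqP.
have [[i5 iE]|[x [xv ix iE]]] := nth_relators ilt.
  have [N [nN N_basics N_exp4 N_i]] := basic_separated i5.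
  exists N; rewrite iE; split=> // j jlt ji.
  have [[j5 ->]|[y [_ _ ->]]] := nth_relators jlt; first exact: N_basics.
  by rewrite /relator iter_sigmaX; apply: N_exp4.
have [N [nN N_basics N_others N_x _]] := separates_exists hn xv.
exists N; rewrite iE; split=> // j jlt ji.
have [[j5 ->]|[y [yv jy ->]]] := nth_relators jlt.
  by apply: N_basics; apply: mem_nth.
(* The position is a function of the index, so distinct positions carry distinct indices. *)
by apply: N_others => // yx; apply: ji; rewrite jy ix yx.
Qed.
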